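(* Let $a<x<b$ be real numbers, let $f\in C^1([a,b])$, let $0<\beta\le1$ and $0\le\alpha\le1$, and let $0<\epsilon<b-x$. Then $$\mathcal{S}^{\epsilon+}_{\alpha}\big[{}_a\mathbf{I}^{\beta}f\big](x)=\frac{\epsilon^{\alpha}\,(x+\epsilon-a)^{\beta-1}}{(1-\{\alpha\})\,\Gamma(\beta)}\,f(a)+\frac{\epsilon^{\alpha}}{1-\{\alpha\}}\;{}_a\mathbf{D}^{1-\beta}f(x+\epsilon).$$
   Context: $\{\alpha\}$ denotes the fractional part of $\alpha$ (so $\{1\}=0$) and $\Gamma$ is Euler's Gamma function. For a function $g$ differentiable at $x+\epsilon$, $\epsilon>0$, the forward scale velocity of order $\alpha$ is $$\mathcal{S}^{\epsilon+}_{\alpha}[g](x)=\frac{\epsilon^{\alpha}}{1-\{\alpha\}}\,\frac{\partial}{\partial\epsilon}g(x+\epsilon).$$ The Riemann–Liouville fractional integral of order $\beta>0$ with lower endpoint $a$ is the function ${}_a\mathbf{I}^{\beta}f$ given by $${}_a\mathbf{I}^{\beta}f(y)=\frac{1}{\Gamma(\beta)}\int_a^{y}f(t)\,(y-t)^{\beta-1}\,dt .$$ The Caputo fractional derivative of order $\gamma\in[0,1)$ with lower endpoint $a$ is $${}_a\mathbf{D}^{\gamma}f(y)=\frac{1}{\Gamma(1-\gamma)}\int_a^{y}\frac{f'(t)}{(y-t)^{\gamma}}\,dt .$$ *)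

(* Defs.v *)
From HB Require Import structures.
From mathcomp Require Import all_boot all_order all_algebra.
From mathcomp Require Import all_classical all_reals all_analysis.

Set Implicit Arguments.
Unset Strict Implicit.
Unset Printing Implicit Defensive.
Import Order.TTheory GRing.Theory Num.Theory.
Import numFieldNormedType.Exports.

Local Open Scope classical_set_scope.
Local Open Scope ring_scope.

Definition fractional_part (R : realType) (r : R) : R := r - (Num.floor r)%:~R.

(* Euler's integral; it represents Gamma only for positive arguments. *)
Definition Gamma (R : realType) (z : R) : R :=
  \int[lebesgue_measure]_(t in `]0, +oo[) (t `^ (z - 1) * expR (- t)).

(* [f] has derivative [l] at [x] relative to [A]: for A = `[a, b] this is the
   one-sided derivative at the endpoints and the usual one in the interior. *)
Definition has_derivative_within (R : realType) (A : set R) (f : R -> R)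
    (x l : R) : Prop :=
  (f y - f x) / (y - x) @[y --> within A x^'] --> l.

Definition C1_on (R : realType) (a b : R) (f : R -> R) : Prop :=
  exists2 f' : R -> R,
    {within `[a, b], continuous f'} &
    forall x, x \in `[a, b] -> has_derivative_within `[a, b] f x (f' x).

Definition forward_scale_velocity (R : realType) (alpha eps : R) (g : R -> R)
    (x : R) : R :=
  eps `^ alpha / (1 - fractional_part alpha) *
  derive1 (fun e : R => g (x + e)) eps.

(* The integrals from a to y (with a < y) are Lebesgue integrals over the open
   interval: the kernel may be singular at y, and for f of class C^1 on [a, b]
   the two-sided derivative [derive1 f] need only exist inside ]a, b[. *)
Definition RL_integral (R : realType) (a beta : R) (f : R -> R) (y : R) : R :=
  (Gamma beta)^-1 *
  \int[lebesgue_measure]_(t in `]a, y[) (f t * (y - t) `^ (beta - 1)).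

Definition Caputo_derivative (R : realType) (a gamma : R) (f : R -> R)
    (y : R) : R :=
  (Gamma (1 - gamma))^-1 *
  \int[lebesgue_measure]_(t in `]a, y[) (derive1 f t / (y - t) `^ gamma).

(* Main.v *)
Require Import Defs.
From HB Require Import structures.
From mathcomp Require Import all_boot all_order all_algebra.
From mathcomp Require Import all_classical all_reals all_analysis.
From mathcomp Require Import measurable_realfun ring lra.

Set Implicit Arguments.
Unset Strict Implicit.
Unset Printing Implicit Defensive.
Import Order.TTheory GRing.Theory Num.Theory.
Import numFieldNormedType.Exports.

Local Open Scope classical_set_scope.
Local Open Scope ring_scope.

(** For [beta < 1] the kernel [(y - t) `^ (beta - 1)] is singular at the moving
endpoint [y], so the integral cannot be differentiated under the sign in its given form.
Substituting [s = y - t] fixes the singularity at [s = 0] and moves the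
dependence on [y] into the regular factor [f (y - s)].  What remains is that the
domain [0 < s < y - a] still depends on [y].

To remove it, write [f = f a + F], with [F = f - f a] on [[a, b]] continued by
the constants [0] to the left of [a] and [f b - f a] to the right of [b].  The
constant part integrates explicitly to [f a * (y - a) `^ beta / beta]
([integral_powR]), whose derivative is the boundary term of the theorem.  As [F]
vanishes to the left of [a], the other part is the integral of
[F (y - s) * s `^ (beta - 1)] over the fixed interval [0 < s < b - a].

The function [F] is globally Lipschitz because [f'] is bounded on [[a, b]]
([C1_on_lipschitz], [clamp_lipschitz]), so its difference quotients are bounded
by a constant, and the integrands of the difference quotients by a constant
times [s `^ (beta - 1)], which is integrable as [beta > 0].  They converge
except where [y - s] is the kink [a] of [F], a single point.  Dominated convergence
([is_derive_lipschitz_convolution]) gives the integral of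
[F' (y - s) * s `^ (beta - 1)], and undoing the substitution turns it into the
integral of [f' t * (y - t) `^ (beta - 1)], the one in the Caputo derivative of
order [1 - beta].  Both sides carry the same constant factor [1 / Gamma beta],
since [1 - (1 - beta) = beta]. *)

(** * Reflection of the Lebesgue measure *)

Lemma measurable_reflect (R : realType) (y : R) :
  measurable_fun [set: measurableTypeR R] (fun t : R => y - t : measurableTypeR R).
Proof. exact: measurable_funB. Qed.

(** By uniqueness of the Lebesgue measure it suffices to compare the two sides on
half-open intervals; the reflection swaps which end is open, which does not
change the length. *)
Lemma lebesgue_measure_reflect (R : realType) (y : R) (A : set R) :
  measurable A ->
  lebesgue_measure A = lebesgue_measure [set t | A (y - t)].
Proof.
move=> mA.
pose pm := [the measure _ _ of
  pushforward (@lebesgue_measure R) (fun t => y - t : measurableTypeR R)].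
pose m := pm (measurable_reflect y).
rewrite -[RHS]/(m A).
apply: lebesgue_measure_unique mA => _ [[u v] _ <-] /=.
rewrite /pushforward.
have -> : (fun t : R => y - t) @^-1` `]u, v] = `[y - v, y - u[%classic.
  by apply/seteqP; split=> t /=; rewrite !in_itv/= => /andP[? ?]; apply/andP;
    split; lra.
rewrite !lebesgue_measure_itv/= !lte_fin ltrD2l ltrN2; case: ifPn => // _.
by rewrite -!EFinB; congr EFin; ring.
Qed.

(** The two sides agree on the positive and negative parts of [f], hence on [f]
itself even when its integral is infinite. *)
Lemma integral_reflect (R : realType) (y : R) (D : set R) (f : R -> \bar R) :
  measurable D -> measurable_fun D f ->
  (\int[lebesgue_measure]_(t in D) f t =
   \int[lebesgue_measure]_(s in [set s | D (y - s)%R]) f (y - s)%R)%E.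
Proof.
move=> mD mf.
have push g : measurable_fun D g -> (forall t, 0 <= g t)%E ->
  (\int[lebesgue_measure]_(t in D) g t =
   \int[lebesgue_measure]_(s in [set s | D (y - s)%R]) g (y - s)%R)%E.
  move=> mg g0; have mphi := measurable_reflect y.
  rewrite -(ge0_integral_pushforward mphi lebesgue_measure mD mg)//.
  by apply: eq_measure_integral => A mA _; exact: lebesgue_measure_reflect.
rewrite integralE [RHS]integralE; congr (_ - _)%E.
  rewrite push//; last exact: measurable_funepos.
  by apply: eq_integral => s _; rewrite !funeposE.
rewrite push//; last exact: measurable_funeneg.
by apply: eq_integral => s _; rewrite !funenegE.
Qed.

Lemma Rintegral_reflect (R : realType) (a y : R) (f : R -> R) :
  measurable_fun `]a, y[ f ->
  \int[lebesgue_measure]_(t in `]a, y[) f t =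
  \int[lebesgue_measure]_(s in `]0, y - a[) f (y - s).
Proof.
move=> mf; rewrite /Rintegral (integral_reflect y)//; last exact/measurable_EFinP.
congr (fine (integral _ _ _)).
by apply/seteqP; split=> t /=; rewrite !in_itv/= => /andP[? ?]; apply/andP;
  split; lra.
Qed.

(** * Integrals of powers near zero *)

(** For [beta < 1] the integrand is unbounded at [0], so the fundamental theorem
of calculus applies only away from [0]; the intervals [[u n, r]] with
[u n = r / (n + 2)] exhaust []0, r]] and monotone convergence passes to the
limit. *)
Lemma integral_powR (R : realType) (beta r : R) : 0 < beta -> 0 < r ->
  (\int[lebesgue_measure]_(s in `]0%R, r[) (s `^ (beta - 1))%:E =
   (r `^ beta / beta)%:E)%E.
Proof.
move=> beta0 r0.
have mk A : measurable_fun A (fun s : R => (s `^ (beta - 1))%:E).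
  by apply/measurable_EFinP/measurable_funTS; exact: measurable_powR.
rewrite integral_itv_bndo_bndc//.
(* The denominator starts at 2 so that [u n < r] holds from [n = 0] on. *)
pose u n : R := r / n.+2%:R.
have u0 n : 0 < u n by rewrite divr_gt0.
have ur n : u n < r by rewrite ltr_pdivrMr// ltr_pMr// ltr1n.
have u_cvg : u @ \oo --> (0 : R).
  rewrite -[X in _ --> X](mulr0 r); apply: cvgMr.
  by have := @cvg_harmonic R; rewrite -cvg_shiftS.
have -> : `]0, r]%classic = \bigcup_n `[u n, r]%classic.
  apply/seteqP; split=> [t /=|t [n _]/=]; rewrite !in_itv/=; last first.
    by move=> /andP[ut ->]; rewrite andbT (lt_le_trans _ ut).
  move=> /andP[t0 tr].
  have [N _ /(_ N (leqnn N)) uN] := cvgr_lt _ u_cvg _ t0.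
  by exists N => //=; rewrite in_itv/= tr (ltW uN).
have powR_cvg : (\int[lebesgue_measure]_(s in `[u i, r])
    (s `^ (beta - 1))%:E @[i --> \oo] --> (r `^ beta / beta)%:E)%E.
  have Eu n : (\int[lebesgue_measure]_(s in `[u n, r]) (s `^ (beta - 1))%:E =
      (r `^ beta / beta - u n `^ beta / beta)%:E)%E.
    have der (z : R) : 0 < z ->
        is_derive z 1 (fun s : R => s `^ beta / beta) (z `^ (beta - 1)).
      move=> z0; have dz := is_derive1_powR beta z0.
      rewrite (_ : (fun s : R => _) = beta^-1 \*: (fun s : R => s `^ beta));
          last first.
        by apply/funext => s /=; rewrite mulrC.
      apply: is_derive_eq; rewrite /GRing.scale/= mulKf// gt_eqF//.
    rewrite (@continuous_FTC2 _ _ (fun s : R => s `^ beta / beta))//.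
    - apply: derivable_within_continuous => z; rewrite in_itv/= => /andP[uz _].
      by apply: derivable_powR; rewrite in_itv/= andbT (lt_le_trans _ uz).
    - have cont (z : R) : 0 < z ->
          {for z, continuous (fun s : R => s `^ beta / beta)}.
        move=> z0; apply/differentiable_continuous/derivable1_diffP.
        by have [] := der z z0.
      split.
      + move=> z; rewrite in_itv/= => /andP[uz _].
        by have [] := der z (lt_trans (u0 n) uz).
      + exact/cvg_at_right_filter/cont.
      + exact/cvg_at_left_filter/cont.
    - move=> z; rewrite in_itv/= => /andP[uz _].
      by rewrite derive1E; have [_ ->] := der z (lt_trans (u0 n) uz).
  rewrite (eq_cvg _ _ Eu); apply: cvg_EFin; first exact: nearW.
  rewrite -[X in _ --> X]subr0 -[X in _ - X](mul0r beta^-1).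
  apply: cvgB; first exact: cvg_cst.
  apply: cvgMl.
  have := powR_cvg0 beta0 => /cvg_at_rightP; exact.
apply: cvg_unique powR_cvg => //.
apply: ge0_nondecreasing_set_cvg_integral => //.
- move=> m n mn; apply/subsetPset => t /=; rewrite !in_itv/= => /andP[ut ->].
  rewrite andbT (le_trans _ ut)// ler_pM2l// lef_pV2 ?posrE//.
  by rewrite ler_nat.
- by move=> i; exact: mk.
- by move=> i t _; rewrite lee_fin powR_ge0.
Qed.

Lemma integrable_powR (R : realType) (beta r : R) : 0 < beta -> 0 < r ->
  (@lebesgue_measure R).-integrable `]0, r[ (EFin \o (fun s => s `^ (beta - 1))).
Proof.
move=> beta0 r0; apply/integrableP; split.
  by apply/measurable_EFinP/measurable_funTS; exact: measurable_powR.
under eq_integral do rewrite /= ger0_norm ?powR_ge0//.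
by rewrite integral_powR// ltry.
Qed.

(** * Differentiating the convolution of a Lipschitz function *)

Lemma lipschitz_measurable (R : realType) (F : R -> R) (L : R) :
  (forall s t, `|F s - F t| <= L * `|s - t|) -> measurable_fun setT F.
Proof.
move=> lipF; apply: continuous_measurable_fun => s; apply/cvgrPdist_le => e e0.
have L0 : 0 <= L.
  by have := lipF 1 0; rewrite subr0 normr1 mulr1; exact: le_trans.
apply/nbhs_ballP; exists (e / (L + 1)) => /=; first by rewrite divr_gt0// ltr_wpDl.
move=> t; rewrite /ball/= ltr_pdivlMr ?ltr_wpDl// => st.
apply: le_trans (lipF _ _) (le_trans _ (ltW st)).
by rewrite mulrC ler_wpM2l// lerDl.
Qed.

Lemma lipschitz_integrable_convolution (R : realType) (F k : R -> R)
    (c L y : R) :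
  (@lebesgue_measure R).-integrable `]0, c[ (EFin \o k) ->
  (forall s t, `|F s - F t| <= L * `|s - t|) ->
  (@lebesgue_measure R).-integrable `]0, c[ (EFin \o (fun s => F (y - s) * k s)).
Proof.
move=> ik lipF; have mF := lipschitz_measurable lipF.
have L0 : 0 <= L.
  by have := lipF 1 0; rewrite subr0 normr1 mulr1; exact: le_trans.
rewrite (_ : _ \o _ =
    ((EFin \o (fun s => F (y - s)%R)) \* (EFin \o k))%E)//.
apply: integrableMr => //.
  exact: (measurableT_comp mF (measurable_funTS (measurable_reflect y))).
exists (`|F y| + L * c); split; first exact: num_real.
move=> M FM s; rewrite /= in_itv/= => /andP[s0 sc].
apply: le_trans (ltW FM).
rewrite -[F (y - s)](subrK (F y)) addrC (le_trans (ler_normD _ _))// lerD2l.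
rewrite (le_trans (lipF _ _))// addrAC subrr add0r normrN gtr0_norm//.
by rewrite ler_wpM2l// ltW.
Qed.

(** The Lipschitz bound replaces the usual hypothesis that [F] is differentiable
everywhere with bounded derivative: the difference quotients of [F] are at most
[L] in absolute value even across a point of non-differentiability, so [L * `|k|]
dominates.  Hence one exceptional value [p] of [s] is harmless, being a null
set; this is what allows [F] to have a kink. *)
Lemma is_derive_lipschitz_convolution (R : realType) (F G k : R -> R)
    (c L y p : R) :
  (@lebesgue_measure R).-integrable `]0, c[ (EFin \o k) ->
  (forall s t, `|F s - F t| <= L * `|s - t|) ->
  measurable_fun `]0, c[ G ->
  (forall s, 0 < s < c -> s != p -> is_derive (y - s) 1 F (G s)) ->
  is_derive y 1
    (fun z => \int[lebesgue_measure]_(s in `]0, c[) (F (z - s) * k s))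
    (\int[lebesgue_measure]_(s in `]0, c[) (G s * k s)).
Proof.
move=> ik lipF mG derF.
have mk : measurable_fun `]0, c[ k.
  by move/measurable_int : ik => /measurable_EFinP.
have iFk z := lipschitz_integrable_convolution z ik lipF.
pose H z := \int[lebesgue_measure]_(s in `]0, c[) (F (z - s) * k s).
suff cvgH : h^-1 *: (H (h *: 1 + y) - H y) @[h --> 0^'] -->
    \int[lebesgue_measure]_(s in `]0, c[) (G s * k s).
  by apply: DeriveDef; [apply/cvg_ex; eexists; exact: cvgH|exact/cvg_lim/cvgH].
apply/cvgr_dnbhsP => h [h0 h_cvg].
pose q n s := (h n)^-1 * (F (h n + y - s) - F (y - s)) * k s.
have iq n : (@lebesgue_measure R).-integrable `]0, c[ (EFin \o q n).
  rewrite (_ : _ \o _ = (fun s => (h n)^-1%:E *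
      ((F (h n + y - s) * k s)%:E - (F (y - s) * k s)%:E))%E); last first.
    by apply/funext => s; rewrite /q /= -EFinB -EFinM -mulrBl mulrA.
  apply: integrableZl => //.
  exact: (integrableB _ (iFk (h n + y)) (iFk y)).
have Eq n : (h n)^-1 *: (H (h n *: 1 + y) - H y) =
    \int[lebesgue_measure]_(s in `]0, c[) q n s.
  rewrite scaler1 /H -RintegralB// /GRing.scale/= -RintegralZl//; last first.
    exact: (integrableB _ (iFk (h n + y)) (iFk y)).
  by apply: eq_Rintegral => s _; rewrite /q -mulrBl mulrA.
rewrite (eq_cvg _ _ Eq).
have mGk : measurable_fun `]0, c[ (EFin \o (fun s => G s * k s)).
  exact/measurable_EFinP/measurable_funM.
have ig : (@lebesgue_measure R).-integrable `]0, c[ (fun s => L%:E * `|(k s)%:E|)%E.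
  by apply: integrableZl => //; exact: integrable_abse.
have mq n := measurable_int _ (iq n).
have [|||intGk _ cvgq] := dominated_convergence _ mq mGk _ ig.
- by [].
- exists [set p]; split => //; first exact: lebesgue_measure_set1.
  move=> s /= qs; apply: contrapT => /eqP sp; apply: qs => /= sc.
  have [dF <-] := derF s sc sp.
  apply: cvg_EFin; first exact: nearW.
  apply: cvgMl.
  have /cvgr_dnbhsP/(_ h (conj h0 h_cvg)) := dF.
  by apply: cvg_trans; apply: near_eq_cvg; apply: nearW => n; rewrite /= scaler1 addrA.
- apply: aeW => s n sc /=.
  rewrite lee_fin normrM ler_wpM2r// normrM normfV.
  rewrite ler_pdivrMl ?normr_gt0// mulrC (le_trans (lipF _ _))//.
  by rewrite opprB addrA subrK addrK.
have iGk : (\int[lebesgue_measure]_(s in `]0%R, c[) (G s * k s)%:E)%E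
    \is a fin_num.
  exact: integrable_fin_num.
by apply: fine_cvg; rewrite fineK.
Qed.

(** * Functions of class C1 on a segment *)

(** Multiplying by [z - x] clears the denominator, so that the estimate holds
at [z = x] too. *)
Lemma has_derivative_within_expansion (R : realType) (A : set R) (f : R -> R)
    (x l e : R) :
  has_derivative_within A f x l -> 0 < e ->
  exists2 d, 0 < d & forall z, `|x - z| < d -> A z ->
    `|f z - f x - l * (z - x)| <= e * `|z - x|.
Proof.
move=> /cvgrPdist_le/[apply]/nbhs_ballP[d /= d0 xd]; exists d => // z xz Az.
have [->|zx] := eqVneq z x; first by rewrite !subrr mulr0 subr0 normr0 mulr0.
rewrite -ler_pdivrMr ?normr_gt0 ?subr_eq0// -normf_div mulrBl mulfK ?subr_eq0//.
by rewrite distrC; exact: xd.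
Qed.

Lemma has_derivative_within_continuous (R : realType) (A : set R)
    (f f' : R -> R) :
  (forall x, A x -> has_derivative_within A f x (f' x)) ->
  {within A, continuous f}.
Proof.
move=> df; apply/subspace_continuousP => x Ax.
have [d d0 xd] := has_derivative_within_expansion (df x Ax) ltr01.
apply/cvgrPdist_le => e e0; apply/nbhs_ballP.
have K0 : 0 < 1 + `|f' x| by rewrite ltr_wpDr.
exists (Num.min d (e / (1 + `|f' x|))) => /=.
  by rewrite lt_min d0 divr_gt0.
move=> z; rewrite /ball/= lt_min => /andP[xzd].
rewrite ltr_pdivlMr// => xze Az; apply: le_trans (ltW xze).
have := xd z xzd Az; rewrite mul1r (distrC x z) (distrC (f x)) => zx.
rewrite -[f z - f x](subrK (f' x * (z - x))) (le_trans (ler_normD _ _))//.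
by rewrite [leRHS]mulrDr mulr1 lerD// normrM mulrC.
Qed.

Lemma has_derivative_within_is_derive (R : realType) (a b : R) (f : R -> R)
    (x l : R) :
  a < x < b -> has_derivative_within `[a, b] f x l -> is_derive x 1 f l.
Proof.
move=> /andP[ax xb] df.
suff cvgf : h^-1 *: (f (h *: 1 + x) - f x) @[h --> 0^'] --> l.
  by apply: DeriveDef; [apply/cvg_ex; exists l|exact/cvg_lim/cvgf].
apply/cvgrPdist_le => e e0.
have [d d0 xd] := has_derivative_within_expansion df e0.
near=> h.
have h0 : h != 0 by near: h; exact: nbhs_dnbhs_neq.
have hd : `|h| < d by near: h; exact: dnbhs0_lt.
have hab : `|h| < Num.min (x - a) (b - x).
  by near: h; apply: dnbhs0_lt; rewrite lt_min !subr_gt0 ax.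
have := xd (x + h); rewrite opprD addrA subrr sub0r normrN => /(_ hd).
have /[swap]/[apply] : `[a, b]%classic (x + h).
  move: hab; rewrite lt_min /= in_itv/= !ltr_norml => /andP[/andP[? ?] /andP[? ?]].
  by apply/andP; split; lra.
rewrite [x + h - x]addrAC subrr add0r -ler_pdivrMr ?normr_gt0// -normf_div.
by rewrite mulrBl mulfK// distrC scaler1 (addrC h) /GRing.scale/= (mulrC h^-1).
Unshelve. all: by end_near. Qed.

Lemma C1_on_continuous (R : realType) (a b : R) (f : R -> R) :
  C1_on a b f -> {within `[a, b], continuous f}.
Proof.
move=> [f' _ df].
by apply: (has_derivative_within_continuous (f' := f')) => t; exact: df.
Qed.

Lemma C1_on_is_derive (R : realType) (a b t : R) (f : R -> R) :
  C1_on a b f -> a < t < b -> is_derive t 1 f (derive1 f t).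
Proof.
move=> [f' _ df] /[dup] tab /andP[at_ tb].
have dft : is_derive t 1 f (f' t).
  apply: has_derivative_within_is_derive tab _; apply: df.
  by rewrite in_itv/= !ltW.
by rewrite derive1E derive_val.
Qed.

(** The interval is open because [derive1 f] may differ from the one-sided
derivative at an endpoint, where [f] need not be differentiable from both sides. *)
Lemma C1_on_measurable_derive1 (R : realType) (a b : R) (f : R -> R) :
  C1_on a b f -> measurable_fun `]a, b[ (derive1 f).
Proof.
move=> [f' cf' df].
apply: (@eq_measurable_fun _ _ _ _ _ f').
  move=> t; rewrite inE/= in_itv/= => tab.
  have tab' : t \in `[a, b] by case/andP: tab => ? ?; rewrite in_itv/= !ltW.
  have [_ <-] := has_derivative_within_is_derive tab (df t tab').
  by rewrite derive1E.
apply: (@measurable_funS _ _ _ _ `[a, b]%classic) => //.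
  exact: subset_itv_oo_cc.
exact: subspace_continuous_measurable_fun.
Qed.

(** Mean value theorem, with the bound on [f'] obtained from its extreme values. *)
Lemma C1_on_lipschitz (R : realType) (a b : R) (f : R -> R) :
  a < b -> C1_on a b f ->
  exists L, forall s t, s \in `[a, b] -> t \in `[a, b] ->
    `|f s - f t| <= L * `|s - t|.
Proof.
move=> ab fC1; have cf := C1_on_continuous fC1.
have [f' cf' df] := fC1.
have [u _ f'u] := EVT_max (ltW ab) cf'; have [v _ f'v] := EVT_min (ltW ab) cf'.
exists (`|f' u| + `|f' v|) => s t.
wlog st : s t / s < t => [wlg sab tab|].
  have [st|ts|->] := ltgtP s t; first exact: wlg.
    by rewrite distrC (distrC s) wlg.
  by rewrite !subrr normr0 mulr0.
rewrite !in_itv/= => /andP[as_ sb] /andP[at_ tb].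
have [||c cst] := @MVT _ f f' s t st.
- move=> c; rewrite in_itv/= => /andP[sc ct].
  apply: (@has_derivative_within_is_derive _ a b).
    by rewrite (le_lt_trans as_ sc) (lt_le_trans ct tb).
  by apply: df; rewrite in_itv/= (le_trans as_ (ltW sc)) (le_trans (ltW ct) tb).
- apply: continuous_subspaceW cf => c /=; rewrite !in_itv/= => /andP[sc ct].
  by rewrite (le_trans as_ sc) (le_trans ct tb).
rewrite (distrC (f s)) (distrC s) => ->; rewrite normrM ler_wpM2r//.
have cab : c \in `[a, b].
  move: cst; rewrite !in_itv/= => /andP[sc ct].
  by rewrite (le_trans as_ (ltW sc)) (le_trans (ltW ct) tb).
have [vc cu] := (f'v c cab, f'u c cab).
have [nu nv] := (ler_norm (f' u), ler_norm (- f' v)); rewrite normrN in nv.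
rewrite ler_norml; apply/andP; split.
  by have := normr_ge0 (f' u); lra.
by have := normr_ge0 (f' v); lra.
Qed.

(** * The derivative of a power convolution *)

(** The nearest point to [t] in [[a, b]] when [a <= b]; composing with it continues
a function on [[a, b]] by constants and preserves its Lipschitz constant. *)
Definition clamp (R : realType) (a b t : R) : R := Num.max a (Num.min b t).

Lemma clamp_in (R : realType) (a b t : R) : a <= b -> clamp a b t \in `[a, b].
Proof.
by move=> ab; rewrite in_itv/= le_max lexx/= ge_max ab ge_min lexx.
Qed.

Lemma clamp_id (R : realType) (a b t : R) : a <= t <= b -> clamp a b t = t.
Proof. by move=> /andP[ta tb]; rewrite /clamp (min_idPr tb) (max_idPr ta). Qed.

Lemma clamp_le (R : realType) (a b t : R) : a <= b -> t <= a -> clamp a b t = a.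
Proof.
by move=> ab ta; rewrite /clamp; apply/max_idPl; rewrite ge_min ta orbT.
Qed.

Lemma clamp_lipschitz (R : realType) (a b s t : R) :
  `|clamp a b s - clamp a b t| <= `|s - t|.
Proof.
wlog st : s t / s <= t => [wlg|].
  have [/wlg//|/ltW/wlg] := leP s t.
  by rewrite distrC (distrC t).
rewrite (distrC s) (ger0_norm (x := t - s)) ?subr_ge0// distrC ler_norml.
rewrite /clamp; case: (leP b s) => ?; case: (leP b t) => ?; case: (leP a b) => ?;
  by case: (leP a s) => ?; case: (leP a t) => ?; apply/andP; split; lra.
Qed.

(** The analytic content of the theorem, free of the factors in [Gamma beta],
[eps] and [alpha].  For [beta < 1], Leibniz's rule on the integral as it stands
would yield the limit of [f t * (y - t) `^ (beta - 1)] at [t = y] and an integral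
of [f t * (y - t) `^ (beta - 2)], both divergent when [f y != 0]; fixing the
singularity at [s = 0] first puts the derivative on [f] instead. *)
Lemma is_derive_convolution_powR (R : realType) (a b beta y : R) (f : R -> R) :
  C1_on a b f -> 0 < beta -> a < y < b ->
  is_derive y 1
    (fun z => \int[lebesgue_measure]_(t in `]a, z[)
                (f t * (z - t) `^ (beta - 1)))
    (f a * (y - a) `^ (beta - 1) +
     \int[lebesgue_measure]_(t in `]a, y[)
       (derive1 f t * (y - t) `^ (beta - 1))).
Proof.
move=> fC1 beta0 /andP[ay yb]; have ab := lt_trans ay yb.
have [L lipf] := C1_on_lipschitz ab fC1.
have cf := C1_on_continuous fC1.
have mf z : z < b -> measurable_fun `]a, z[ f.
  move=> zb; apply: (@measurable_funS _ _ _ _ `[a, b]%classic) => //.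
    by move=> t /=; rewrite !in_itv/= => /andP[? ?]; apply/andP; split; lra.
  exact: subspace_continuous_measurable_fun.
have mdf : measurable_fun `]a, y[ (derive1 f).
  apply: measurable_funS (C1_on_measurable_derive1 fC1) => //.
  by move=> t /=; rewrite !in_itv/= => /andP[? ?]; apply/andP; split; lra.
pose k s : R := s `^ (beta - 1).
have mk : measurable_fun setT k by exact: measurable_powR.
have mky (z : R) (D : set R) : measurable D ->
    measurable_fun D (fun t : R => k (z - t)).
  by move=> mD; apply: measurable_funTS; apply: (measurableT_comp mk);
    exact: measurable_reflect.
(* Subtracting [f a] makes [F] vanish to the left of [a], so that integrating over
   the fixed interval below adds nothing. *)
pose F t := f (clamp a b t) - f a.
have F0 t : t <= a -> F t = 0 by move=> ta; rewrite /F clamp_le ?subrr// ltW.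
have FE t : a <= t <= b -> F t = f t - f a by move=> tab; rewrite /F clamp_id.
have lipF s t : `|F s - F t| <= L * `|s - t|.
  have L0 : 0 <= L.
    have := lipf b a; rewrite !in_itv/= !lexx ltW// => /(_ isT isT).
    move=> /(le_trans (normr_ge0 _)); rewrite pmulr_lge0// normr_gt0 subr_eq0.
    by rewrite gt_eqF.
  rewrite /F opprB addrA subrK.
  apply: le_trans (lipf _ _ (clamp_in s (ltW ab)) (clamp_in t (ltW ab))) _.
  by rewrite ler_wpM2l// clamp_lipschitz.
have ik : (@lebesgue_measure R).-integrable `]0, (b - a)[ (EFin \o k).
  by apply: integrable_powR => //; rewrite subr_gt0.
(* This holds for every [z] near [y], so both sides have the same derivative. *)
have split_conv z : a < z < b ->
    \int[lebesgue_measure]_(t in `]a, z[) (f t * k (z - t)) =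
    f a * ((z - a) `^ beta / beta) +
    \int[lebesgue_measure]_(s in `]0, (b - a)[) (F (z - s) * k s).
  move=> /andP[az zb].
  have sub : `]0, z - a[ `<=` `]0, b - a[.
    by move=> s /=; rewrite !in_itv/= => /andP[? ?]; apply/andP; split; lra.
  rewrite Rintegral_reflect; last first.
    by apply: measurable_funM; [exact: mf|exact: mky].
  have -> : \int[lebesgue_measure]_(s in `]0, (b - a)[) (F (z - s) * k s) =
      \int[lebesgue_measure]_(s in `]0, (z - a)[) (F (z - s) * k s).
    rewrite -[in RHS](setIidr sub) Rintegral_mkcondr; apply: eq_Rintegral => s.
    rewrite inE/= patchE in_itv/= => /andP[s0 sc]; case: ifPn => //.
    rewrite notin_setE/= in_itv/= s0/= => /negP; rewrite -leNgt => zas.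
    by rewrite F0 ?mul0r//; lra.
  have -> : (z - a) `^ beta / beta = \int[lebesgue_measure]_(s in `]0, z - a[) k s.
    by rewrite /Rintegral integral_powR// subr_gt0.
  have ikz : (@lebesgue_measure R).-integrable `]0, (z - a)[ (EFin \o k).
    exact: integrableS ik.
  rewrite -RintegralZl// -RintegralD//; last 2 first.
  - exact: (integrableZl _ (f a) ikz).
  - exact: integrableS (lipschitz_integrable_convolution z ik lipF).
  apply: eq_Rintegral => s; rewrite inE/= in_itv/= => /andP[s0 sz].
  rewrite FE; last by apply/andP; split; lra.
  by rewrite -mulrDl subrKC subKr.
(* The derivative of [F] at [y - s], except at the kink [s = y - a]. *)
pose G := (fun s => derive1 f (y - s)) \_ `]0, (y - a)[.
have mG : measurable_fun `]0, (b - a)[ G.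
  apply: measurable_funTS.
  apply: (iffLR (measurable_restrictT (fun s : R => derive1 f (y - s)) _)) => //.
  apply: (measurable_comp _ _ mdf) => //.
    move=> _ [s] /= + <-; rewrite !in_itv/= => /andP[? ?].
    by apply/andP; split; lra.
  by apply: measurable_funTS; exact: measurable_reflect.
have derF s : 0 < s < b - a -> s != y - a -> is_derive (y - s) 1 F (G s).
  move=> /andP[s0 sc]; rewrite neq_lt => /orP[sy|ys].
    rewrite /G patchE mem_set/= ?in_itv/= ?s0//.
    have ysab : a < y - s < b by apply/andP; split; lra.
    apply: (near_eq_is_derive (f := fun t => f t - f a)).
      case/andP: (ysab) => ? ?.
      near=> t; rewrite FE//; apply/andP; split; apply: ltW; near: t.
        exact: lt_nbhsr.
      exact: lt_nbhsl.
    by rewrite -[derive1 _ _]subr0; apply: is_deriveB; exact: C1_on_is_derive fC1 _.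
  rewrite /G patchE memNset/=; last by rewrite in_itv/= s0/= lt_gtF.
  apply: (near_eq_is_derive (f := cst 0)).
  near=> t; rewrite F0// ltW//; near: t.
  by apply: lt_nbhsl; lra.
have GE : \int[lebesgue_measure]_(s in `]0, (b - a)[) (G s * k s) =
    \int[lebesgue_measure]_(t in `]a, y[) (derive1 f t * k (y - t)).
  rewrite Rintegral_reflect; last by apply: measurable_funM => //; exact: mky.
  have sub : `]0, y - a[ `<=` `]0, b - a[.
    by move=> s /=; rewrite !in_itv/= => /andP[? ?]; apply/andP; split; lra.
  rewrite -[in RHS](setIidr sub) Rintegral_mkcondr; apply: eq_Rintegral => s.
  rewrite inE/= /G !patchE => sc; case: ifPn => _; last by rewrite mul0r.
  by rewrite subKr.
rewrite -/(k (y - a)) -GE.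
apply: (near_eq_is_derive (f := fun z => f a * ((z - a) `^ beta / beta) +
    \int[lebesgue_measure]_(s in `]0, (b - a)[) (F (z - s) * k s))).
  near=> z; rewrite split_conv//; apply/andP; split; near: z.
    exact: lt_nbhsr.
  exact: lt_nbhsl.
apply: is_deriveD; last exact: is_derive_lipschitz_convolution ik lipF mG derF.
have ya0 : 0 < y - a by rewrite subr_gt0.
have dpow := is_derive1_powR beta ya0.
have dsub : is_derive y 1 (fun z => z - a) 1.
  by rewrite -[X in is_derive _ _ _ X]subr0; apply: is_deriveB.
have dcomp := @is_derive1_comp _ (fun s => s `^ beta) (fun z => z - a) y _ _ dpow dsub.
rewrite (_ : (fun z : R => _) =
    (f a / beta) \*: ((fun s => s `^ beta) \o (fun z => z - a))).
  apply: is_derive_eq.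
  rewrite /GRing.scale/= mulr1 /k mulrA divfK// gt_eqF//.
by apply/funext => z /=; rewrite mulrA mulrAC.
Unshelve. all: by end_near. Qed.

Theorem theorem1 (R : realType) (a x b : R) (f : R -> R)
    (alpha beta eps : R)
    (ax : a < x) (xb : x < b) (fC1 : C1_on a b f)
    (beta_gt0 : 0 < beta) (beta_le1 : beta <= 1)
    (alpha_ge0 : 0 <= alpha) (alpha_le1 : alpha <= 1)
    (eps_gt0 : 0 < eps) (eps_lt : eps < b - x) :
  derivable (RL_integral a beta f) (x + eps) 1 /\
  forward_scale_velocity alpha eps (RL_integral a beta f) x =
    eps `^ alpha * (x + eps - a) `^ (beta - 1) /
      ((1 - fractional_part alpha) * Gamma beta) * f a +
    eps `^ alpha / (1 - fractional_part alpha) *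
      Caputo_derivative a (1 - beta) f (x + eps).
Proof.
have y_ab : a < x + eps < b by apply/andP; split; lra.
have dJ := is_derive_convolution_powR fC1 beta_gt0 y_ab.
pose J z := \int[lebesgue_measure]_(t in `]a, z[) (f t * (z - t) `^ (beta - 1)).
have dRL : is_derive (x + eps) 1 (RL_integral a beta f) ((Gamma beta)^-1 *:
    (f a * (x + eps - a) `^ (beta - 1) + \int[lebesgue_measure]_(t in `]a, x + eps[)
       (derive1 f t * (x + eps - t) `^ (beta - 1)))).
  by rewrite (_ : RL_integral a beta f = (Gamma beta)^-1 \*: J)//; apply: is_deriveZ.
split; first by have [] := dRL.
have dshift : is_derive eps 1 (fun e : R => x + e) 1.
  by rewrite -[X in is_derive _ _ _ X]add0r; apply: is_deriveD.
have dcomp := @is_derive1_comp _ _ (fun e : R => x + e) eps _ _ dRL dshift.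
rewrite /forward_scale_velocity derive1E.
have [_ ->] := dcomp.
rewrite /Caputo_derivative [1 - (1 - beta)]subKr.
have -> : \int[lebesgue_measure]_(t in `]a, x + eps[)
      (derive1 f t / (x + eps - t) `^ (1 - beta)) =
    \int[lebesgue_measure]_(t in `]a, x + eps[)
      (derive1 f t * (x + eps - t) `^ (beta - 1)).
  by apply: eq_Rintegral => t _; rewrite -powRN opprB.
by rewrite /GRing.scale/= mulr1 invfM; ring.
Qed.
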